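(* For every positive integer $k$, with $n=4k$: $$\mathrm{SgnAltrun}_{4k,a,a}(p,q)=\mathrm{SgnAltrun}_{4k,d,d}(p,q)=(1+pq)(1-pq)^{2(k-1)},$$ $$\mathrm{SgnAltrun}_{4k,a,d}(p,q)=-2p(1-pq)^{2(k-1)},\qquad \mathrm{SgnAltrun}_{4k,d,a}(p,q)=-2q(1-pq)^{2(k-1)},$$ $$\mathrm{SgnAltrun}_{4k}(p,q)=2(1-p)(1-q)(1-pq)^{2(k-1)}.$$
   Context: For $\pi=\pi_1\cdots\pi_n\in\mathfrak{S}_n$ let $\mathrm{inv}(\pi)=|\{i<j:\pi_i>\pi_j\}|$, let $\mathrm{pk}(\pi)$ (resp. $\mathrm{val}(\pi)$) be the number of indices $2\le i\le n-1$ with $\pi_{i-1}<\pi_i>\pi_{i+1}$ (resp. $\pi_{i-1}>\pi_i<\pi_{i+1}$). For $n\ge 3$ and $x,y\in\{a,d\}$, let $\mathfrak{S}_{n,x,y}$ be the set of $\pi\in\mathfrak{S}_n$ such that the first pair $(\pi_1,\pi_2)$ is an ascent ($\pi_1<\pi_2$) if $x=a$ and a descent ($\pi_1>\pi_2$) if $x=d$, and the last pair $(\pi_{n-1},\pi_n)$ is an ascent if $y=a$ and a descent if $y=d$. Define $\mathrm{SgnAltrun}_{n,x,y}(p,q)=\sum_{\pi\in\mathfrak{S}_{n,x,y}}(-1)^{\mathrm{inv}(\pi)}p^{\mathrm{pk}(\pi)}q^{\mathrm{val}(\pi)}$ and $\mathrm{SgnAltrun}_n(p,q)=\sum_{\pi\in\mathfrak{S}_n}(-1)^{\mathrm{inv}(\pi)}p^{\mathrm{pk}(\pi)}q^{\mathrm{val}(\pi)}$.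 *)

(* Defs.v *)
From mathcomp Require Import all_boot all_order all_algebra all_fingroup.

Set Implicit Arguments.
Unset Strict Implicit.
Unset Printing Implicit Defensive.

Import GRing.Theory.
Local Open Scope ring_scope.

(* Positions and letters are numbered from 0: [letter s i] is pi_(i+1) - 1
   for i < n; the value for i >= n is irrelevant. *)
Definition letter n (s : 'S_n) (i : nat) : nat :=
  nth 0%N [seq val (s j) | j <- enum 'I_n] i.

Definition inv n (s : 'S_n) : nat :=
  #|[set ij : 'I_n * 'I_n | (ij.1 < ij.2)%N && (s ij.2 < s ij.1)%N]|.

Definition pk n (s : 'S_n) : nat :=
  #|[set i : 'I_n | [&& (0 < i)%N, (i.+1 < n)%N,
       (letter s i.-1 < letter s i)%N & (letter s i > letter s i.+1)%N]]|.

Definition valley n (s : 'S_n) : nat :=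
  #|[set i : 'I_n | [&& (0 < i)%N, (i.+1 < n)%N,
       (letter s i.-1 > letter s i)%N & (letter s i < letter s i.+1)%N]]|.

Inductive step := Asc | Desc.

Definition has_step n (s : 'S_n) (i : nat) (x : step) : bool :=
  match x with
  | Asc => (letter s i < letter s i.+1)%N
  | Desc => (letter s i > letter s i.+1)%N
  end.

(* Meaningful for n >= 2: the last pair sits at positions n - 2 and n - 1. *)
Definition perms_with_ends n (x y : step) : {set 'S_n} :=
  [set s : 'S_n | has_step s 0 x && has_step s (n - 2) y].

(* The enumerators are evaluated at elements p, q of a commutative ring R;
   formal polynomials are the case R = {poly {poly int}}, p and q being its
   two indeterminates. *)
Definition SgnAltrun_ends (R : comNzRingType) n (x y : step) (p q : R) : R :=
  \sum_(s in perms_with_ends n x y)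
    (-1) ^+ inv s * p ^+ pk s * q ^+ valley s.

Definition SgnAltrun (R : comNzRingType) n (p q : R) : R :=
  \sum_(s : 'S_n) (-1) ^+ inv s * p ^+ pk s * q ^+ valley s.

Arguments SgnAltrun_ends {R} n x y p q.
Arguments SgnAltrun {R} n p q.

(* Main.v *)
(* Two sign-reversing involutions leave very few permutations of n = 2m letters.
   First, exchanging two values 2j, 2j+1 that do not stand in adjacent positions
   keeps every ascent and descent, so only the permutations survive in which the
   positions 2i, 2i+1 hold values 2j, 2j+1 for every i. Next, exchanging the
   letters at the positions 2i, 2i+1 of an inner block keeps the numbers of peaks
   and valleys if the steps on the two sides of the block differ, so all steps
   between blocks may be assumed equal. Up to reversing all values, the survivors
   are thus the permutations mapping each block {2i, 2i+1} to itself; reversing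
   the letters of block i multiplies the weight by -p^[i > 0] q^[i < m - 1],
   hence their sum is a product over the blocks. *)
Require Import Defs.
From mathcomp Require Import all_boot all_order all_algebra all_fingroup.
From mathcomp Require Import zify ring.

Set Implicit Arguments.
Unset Strict Implicit.
Unset Printing Implicit Defensive.

Import GRing.Theory Num.Theory.
Local Open Scope ring_scope.

(** * Parity of the inversion number *)

(** Passes to the group-theoretic signature, whose multiplicativity gives the sign changes under the
    involutions. *)
Lemma sign_inv (R : pzRingType) n (s : 'S_n) :
  (-1) ^+ Defs.inv s = (-1) ^+ s :> R.
Proof.
(* Each inverted pair contributes one negative factor. *)
have sgprod (t : 'S_n) : Num.sg (\prod_(i < n) \prod_(j < n | (i < j)%N)
    ((t j)%:Z - (t i)%:Z)) = (-1) ^+ Defs.inv t.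
  rewrite pair_big_dep (big_morph _ (@sgrM int) (sgr1 int)).
  rewrite /Defs.inv -sum1_card -prodrXr big_mkcond [RHS]big_mkcond.
  apply: eq_bigr => [[i j] _] /=; rewrite inE /=.
  case: ltnP => //= ltij.
  have /eqP : t i <> t j by move/perm_inj=> eij; rewrite eij ltnn in ltij.
  rewrite -val_eqE /= => nij.
  case: ltnP => lt_t; first by rewrite ltr0_sg ?subr_lt0 ?ltz_nat.
  by rewrite gtr0_sg ?subr_gt0 ?ltz_nat // ltn_neqAle nij.
have sg1 : Num.sg (\prod_(i < n) \prod_(j < n | (i < j)%N)
    (j%:Z - i%:Z)) = 1.
  rewrite pair_big_dep (big_morph _ (@sgrM int) (sgr1 int)).
  by apply: big1 => [[i j] /= ltij]; rewrite gtr0_sg // subr_gt0 ltz_nat.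
(* Compare the signs of the Vandermonde determinants of s and of the identity. *)
pose a : 'rV[int]_n := \row_j j%:Z; pose b : 'rV[int]_n := \row_j (s j)%:Z.
have /(congr1 Num.sg) : \det (Vandermonde n b) = \det (Vandermonde n a) * (-1) ^+ s.
  have -> : Vandermonde n b = col_perm s (Vandermonde n a).
    by apply/matrixP => i j; rewrite !mxE.
  by rewrite col_permE det_mulmx det_perm odd_permV.
rewrite !det_Vandermonde sgrM.
under eq_bigr do under eq_bigr do rewrite !mxE.
rewrite sgprod => e; rewrite -signr_odd; congr (_ ^+ _); move: e.
under eq_bigr do under eq_bigr do rewrite !mxE.
rewrite sg1 mul1r -signr_odd.
by case: (odd_perm s); case: (odd _).
Qed.

(** * Cancellation by sign-reversing involutions *)

(** The marker [c] splits the terms with [b] into two halves exchanged by [phi], so they cancel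
    without a division by 2. *)
Lemma sum_cancel1 (V : zmodType) (T : finType) (f : T -> V) (P b c : pred T)
    (phi : T -> T) :
  involutive phi ->
  (forall s, P s -> b s ->
     [/\ P (phi s), b (phi s), c (phi s) = ~~ c s & f (phi s) = - f s]) ->
  \sum_(s | P s) f s = \sum_(s | P s && ~~ b s) f s.
Proof.
move=> phiK phiP; rewrite (bigID b) /=.
suff -> : \sum_(s | P s && b s) f s = 0 by rewrite add0r.
have phiE s : P (phi s) && b (phi s) = P s && b s.
  apply/idP/idP => /andP[Ps bs]; have [] := phiP _ Ps bs; last by move=> -> ->.
  by rewrite phiK => -> ->.
rewrite (bigID c) /= [X in X + _](reindex_inj (inv_inj phiK)) /=.
have -> : \sum_(s | P (phi s) && b (phi s) && c (phi s)) f (phi s)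
    = \sum_(s | P s && b s && ~~ c s) - f s.
  apply: eq_big => s; rewrite phiE; case: (boolP (P s && b s)) => //=.
    by case/andP=> Ps bs; have [_ _ ->] := phiP _ Ps bs.
  by case/andP=> Ps bs _; have [] := phiP _ Ps bs.
by rewrite sumrN addNr.
Qed.

(** The involutions are applied one index after another; each preserves every [b j], so it acts on
    what the previous ones have left. *)
Lemma sum_cancel (V : zmodType) (T I : finType) (f : T -> V) (P : pred T)
    (b c : I -> pred T) (phi : I -> T -> T) :
  (forall i, involutive (phi i)) ->
  (forall i s, P s -> b i s ->
     [/\ P (phi i s), forall j, b j (phi i s) = b j s,
         c i (phi i s) = ~~ c i s & f (phi i s) = - f s]) ->
  \sum_(s | P s) f s = \sum_(s | P s && [forall i, ~~ b i s]) f s.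
Proof.
move=> phiK phiP.
suff cancel_seq r : \sum_(s | P s) f s
    = \sum_(s | P s && all (fun i => ~~ b i s) r) f s.
  rewrite (cancel_seq (enum I)); apply: eq_bigl => s; congr (_ && _).
  apply/allP/forallP => [nb i|nb i _]; last exact: nb.
  by apply: nb; rewrite mem_enum.
elim: r => [|i r IHr]; first by apply: eq_bigl => s; rewrite andbT.
rewrite IHr (@sum_cancel1 _ _ _ _ (b i) (c i) (phi i)) //.
  by apply: eq_bigl => s /=; rewrite -andbA [X in _ && X]andbC.
move=> s /andP[Ps nbr] bi; have [-> bE -> ->] := phiP _ _ Ps bi.
by split=> //; [rewrite (eq_all (a2 := fun j => ~~ b j s)) // => j|]; rewrite bE.
Qed.

(** * Peaks, valleys and weights in terms of descents *)

Lemma letterE n (s : 'S_n) (i : 'I_n) : letter s i = s i.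
Proof.
by rewrite /letter (nth_map i) ?nth_ord_enum // -cardE card_ord.
Qed.

Definition desc n (s : 'S_n) (i : nat) : bool :=
  (letter s i.+1 < letter s i)%N.

Lemma descE n (s : 'S_n) (x y : 'I_n) :
  y = x.+1 :> nat -> desc s x = (s y < s x)%N.
Proof. by move=> yx; rewrite /desc -yx !letterE. Qed.

Lemma ascE n (s : 'S_n) i :
  (i.+1 < n)%N -> (letter s i < letter s i.+1)%N = ~~ desc s i.
Proof.
move=> lt_i; rewrite /desc -leqNgt ltn_neqAle andb_idl // => _.
pose x := Ordinal (ltnW lt_i); pose y := Ordinal lt_i.
rewrite -[i.+1]/(val y) -[i]/(val x) !letterE val_eqE (inj_eq perm_inj).
by rewrite -val_eqE /= neq_ltn ltnSn.
Qed.

Definition is_desc (x : step) : bool := if x is Desc then true else false.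

Lemma has_stepE n (s : 'S_n) i x :
  (i.+1 < n)%N -> has_step s i x = (desc s i == is_desc x).
Proof.
by move=> lt_i; case: x; rewrite /= ?ascE // ?eqbF_neg // eqb_id.
Qed.

(** Takes an arbitrary descent predicate, so that valleys are the peaks of the complementary
    predicate. *)
Definition peaks n (d : nat -> bool) : nat :=
  #|[set i : 'I_n | [&& (0 < i)%N, (i.+1 < n)%N, ~~ d i.-1 & d i]]|.

Lemma pkE n (s : 'S_n) : pk s = peaks n (desc s).
Proof.
apply: eq_card => i; rewrite !inE; case: (posnP i) => //= i_gt0.
by case: ltnP => //= lt_i; rewrite -ascE prednK // ltnW.
Qed.

Lemma valleyE n (s : 'S_n) : valley s = peaks n (fun i => ~~ desc s i).
Proof.
apply: eq_card => i; rewrite !inE; case: (posnP i) => //= i_gt0.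
by case: ltnP => //= lt_i; rewrite ascE // negbK /desc prednK.
Qed.

Lemma eq_peaks n (d d' : nat -> bool) :
  (forall i, (i.+1 < n)%N -> d i = d' i) -> peaks n d = peaks n d'.
Proof.
move=> dd'; apply: eq_card => i; rewrite !inE; case: (posnP i) => //= i_gt0.
by case: ltnP => //= lt_i; rewrite !dd' ?prednK // ltnW.
Qed.

Section Weight.
Variables (R : comNzRingType) (p q : R) (n : nat) (x y : bool).

(** The prescribed end steps enter as a factor 0 or 1, so that sums can run over all
    permutations. *)
Definition weight (d : nat -> bool) : R :=
  ((d 0%N == x) && (d (n - 2)%N == y))%:R
  * p ^+ peaks n d * q ^+ peaks n (fun i => ~~ d i).

Lemma eq_weight d d' : (1 < n)%N ->
  (forall i, (i.+1 < n)%N -> d i = d' i) -> weight d = weight d'.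
Proof.
move=> n_gt1 dd'; rewrite /weight !dd' //; last by lia.
by rewrite (eq_peaks dd'); congr (_ * _ ^+ _); apply: eq_peaks => i /dd' ->.
Qed.
End Weight.

Lemma weight_compl (R : comNzRingType) (p q : R) n x y d :
  weight p q n (~~ x) (~~ y) (fun i => ~~ d i) = weight q p n x y d.
Proof.
rewrite /weight !(inj_eq negb_inj) mulrAC; congr (_ * _ ^+ _ * _).
by apply: eq_peaks => i _; rewrite negbK.
Qed.

Lemma SgnAltrun_endsE (R : comNzRingType) (p q : R) n x y : (1 < n)%N ->
  SgnAltrun_ends n x y p q
  = \sum_(s : 'S_n) (-1) ^+ s * weight p q n (is_desc x) (is_desc y) (desc s).
Proof.
move=> n_gt1; rewrite /SgnAltrun_ends big_mkcond; apply: eq_bigr => s _.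
rewrite inE !has_stepE //; last by lia.
rewrite sign_inv pkE valleyE /weight !mulrA.
by case: ifP => _; rewrite ?mulr1 // mulr0 !mul0r.
Qed.

Lemma SgnAltrunE (R : comNzRingType) (p q : R) n : (1 < n)%N ->
  SgnAltrun n p q
  = SgnAltrun_ends n Asc Asc p q + SgnAltrun_ends n Desc Desc p q
    + (SgnAltrun_ends n Asc Desc p q + SgnAltrun_ends n Desc Asc p q).
Proof.
move=> n_gt1; rewrite !SgnAltrun_endsE // -!big_split.
apply: eq_bigr => s _; rewrite sign_inv pkE valleyE /weight /=.
by case: (desc s 0); case: (desc s (n - 2)) => /=;
  rewrite !mul0r !mulr0 !mul1r ?addr0 ?add0r mulrA.
Qed.

(** Strict growth gives [k <= f k] counting from the left, and [f i + (N - 1 - i) < N] counting up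
    to the right end. *)
Lemma incr_bounded_id (f : nat -> nat) N :
  (forall i, (i.+1 < N)%N -> (f i < f i.+1)%N) ->
  (forall i, (i < N)%N -> (f i < N)%N) -> forall i, (i < N)%N -> f i = i.
Proof.
move=> incr lt_f i lt_i.
have ge_f k : (k < N)%N -> (k <= f k)%N.
  by elim: k => // k IHk lt_k; apply: (leq_ltn_trans _ (incr _ lt_k)); apply: IHk; lia.
have step k : (i + k < N)%N -> (f i + k <= f (i + k))%N.
  elim: k => [|k IHk]; rewrite ?addn0 ?addnS // => lt_k.
  by apply: (leq_ltn_trans _ (incr _ lt_k)); apply: IHk; lia.
have := step (N.-1 - i)%N; have := lt_f (i + (N.-1 - i))%N; have := ge_f i lt_i.
by lia.
Qed.

Lemma sum_double (F : nat -> nat) N :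
  (\sum_(x < N.*2) F x = \sum_(i < N) (F i.*2 + F i.*2.+1))%N.
Proof.
elim: N => [|N IHN]; first by rewrite !big_ord0.
by rewrite doubleS !big_ord_recr /= IHN addnA.
Qed.

Lemma peaks_sum n (d : nat -> bool) :
  peaks n d = (\sum_(x < n) [&& 0 < x, x.+1 < n, ~~ d x.-1 & d x])%N.
Proof.
rewrite /peaks -sum1_card big_mkcond; apply: eq_bigr => x _.
by rewrite inE; case: ifP.
Qed.

(** * Blocks of two consecutive positions or values *)

Section Blocks.
Variable m : nat.
Implicit Types (i j : 'I_m) (x y z : 'I_m.*2) (s t : 'S_m.*2).

Fact lo_subproof i : (i.*2 < m.*2)%N. Proof. by rewrite ltn_double. Qed.
Fact hi_subproof i : (i.*2.+1 < m.*2)%N. Proof. by rewrite ltn_Sdouble. Qed.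
Definition lo i := Ordinal (lo_subproof i).
Definition hi i := Ordinal (hi_subproof i).
(** As a left factor, [flip i * s] exchanges two positions; as a right factor, [s * flip i]
    exchanges two values. *)
Definition flip i : 'S_m.*2 := tperm (lo i) (hi i).

Lemma lo_neq_hi i : lo i != hi i. Proof. by rewrite -val_eqE /=; lia. Qed.

Lemma half_lo i : (lo i)./2 = i. Proof. by rewrite /=; lia. Qed.
Lemma half_hi i : (hi i)./2 = i. Proof. by rewrite /=; lia. Qed.

Lemma blockP i x : x./2 = i -> x = lo i \/ x = hi i.
Proof.
move=> xi; case: (boolP (odd x)) => x_odd; [right|left]; apply: val_inj => /=;
  by lia.
Qed.

Lemma half_ltn x : (x./2 < m)%N. Proof. by have := ltn_ord x; lia. Qed.
Definition blk x : 'I_m := Ordinal (half_ltn x).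

Lemma half_flip i x : (flip i x)./2 = x./2.
Proof. by rewrite /flip; case: tpermP => [->|->|//] /=; lia. Qed.

Lemma flip_id i x : x./2 != i -> flip i x = x.
Proof.
move=> xi; rewrite /flip tpermD // -val_eqE /=.
  by apply: contraNneq xi => <-; lia.
by apply: contraNneq xi => <-; lia.
Qed.

Lemma flipK i : involutive (flip i). Proof. exact: tpermK. Qed.

Lemma flip_mulK i : involutive (fun s => (flip i * s)%g).
Proof. by move=> s; rewrite mulgA /flip tperm2 mul1g. Qed.

Lemma mul_flipK i : involutive (fun s => (s * flip i)%g).
Proof. by move=> s; rewrite -mulgA /flip tperm2 mulg1. Qed.

Lemma sign_flip_mul (R : pzRingType) i s :
  (-1) ^+ (flip i * s)%g = - (-1) ^+ s :> R.
Proof. by rewrite odd_permM odd_tperm lo_neq_hi signr_addb mulN1r. Qed.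

Lemma sign_mul_flip (R : pzRingType) i s :
  (-1) ^+ (s * flip i)%g = - (-1) ^+ s :> R.
Proof. by rewrite odd_permM odd_tperm lo_neq_hi signr_addb mulrN1. Qed.

Lemma flip_ltn i x y :
  x./2 != y./2 \/ x./2 != i -> (flip i x < flip i y)%N = (x < y)%N.
Proof.
case: (eqVneq (x./2) (y./2)) => [xy|nxy _].
  by case=> // xi; rewrite !flip_id -?xy.
by have := half_flip i x; have := half_flip i y; lia.
Qed.

(* The values 2i and 2i+1 are not in adjacent positions. *)
Definition spread i s : bool :=
  (((s^-1)%g (lo i)).+1 != (s^-1)%g (hi i) :> nat)
  && (((s^-1)%g (hi i)).+1 != (s^-1)%g (lo i) :> nat).

Definition blockwise s : bool :=
  [forall i, (s (lo i))./2 == (s (hi i))./2].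

Lemma blockwise_half s x y :
  blockwise s -> x./2 = y./2 -> (s x)./2 = (s y)./2.
Proof.
move=> /forallP bw xy; have /eqP e := bw (blk y).
by case: (blockP (i := blk y) xy) => ->;
  case: (blockP (i := blk y) (x := y) erefl) => {2}->.
Qed.

Lemma half_eq_pigeonhole x y z :
  x./2 = y./2 -> y./2 = z./2 -> [|| x == y, y == z | x == z].
Proof. by rewrite -!val_eqE /=; lia. Qed.

(** The two letters in the block of [x] already fill the value block of [s x], leaving no room for a
    third. *)
Lemma blockwise_half_inj s x y :
  blockwise s -> (s x)./2 = (s y)./2 -> x./2 = y./2.
Proof.
move=> bw sxy; have /eqP e := forallP bw (blk x).
have sx : (s (lo (blk x)))./2 = (s x)./2.
  by apply: blockwise_half => //; rewrite half_lo.
have := half_eq_pigeonhole (esym e) (etrans sx sxy).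
rewrite !(inj_eq perm_inj) eq_sym (negPf (lo_neq_hi _)) /=.
by case/orP => /eqP <-; rewrite ?half_lo ?half_hi.
Qed.

Lemma blockwiseP s :
  reflect (forall x y, x./2 = y./2 -> (s x)./2 = (s y)./2) (blockwise s).
Proof.
apply: (iffP idP) => [bw x y|h]; first exact: blockwise_half.
by apply/forallP => i; apply/eqP/h; rewrite half_lo half_hi.
Qed.

(** * First involution: exchanging the values of a block *)

(** Adjacent letters are never the pair 2i, 2i+1, and this is the only pair whose order [flip i]
    changes. *)
Lemma spread_desc i s (k : nat) :
  spread i s -> (k.+1 < m.*2)%N -> desc (s * flip i)%g k = desc s k.
Proof.
move=> /andP[ab ba] lt_k.
pose x := Ordinal (ltnW lt_k); pose y := Ordinal lt_k.
rewrite !(@descE _ _ x y) // !permM; apply: flip_ltn.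
case: (eqVneq (s y)./2 (s x)./2) => [e|]; [right|by left].
apply: contraNneq ab => yi; have xi : (s x)./2 = i by rewrite -e.
have nsxy : s x <> s y by move/perm_inj/(congr1 val) => /=; lia.
case: (blockP xi) (blockP yi) => sx [] sy.
- by case: nsxy; rewrite sx sy.
- by move: ba; rewrite -sx -sy !permK /= eqxx.
- by move: ba; rewrite -sx -sy !permK /= eqxx.
- by case: nsxy; rewrite sx sy.
Qed.

Lemma all_close_blockwise s :
  [forall i, ~~ spread i s] = blockwise s.
Proof.
have closeP i : reflect
    (exists2 x, (s x)./2 = i & exists2 y, (s y)./2 = i & y = x.+1 :> nat)
    (~~ spread i s).
  apply: (iffP idP) => [|[x xi [y yi yx]]].
    rewrite negb_and !negbK => /orP[] /eqP e.
      exists ((s^-1)%g (lo i)); first by rewrite permKV half_lo.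
      by exists ((s^-1)%g (hi i)); rewrite // permKV half_hi.
    exists ((s^-1)%g (hi i)); first by rewrite permKV half_hi.
    by exists ((s^-1)%g (lo i)); rewrite // permKV half_lo.
  have nsxy : s x <> s y by move/perm_inj/(congr1 val) => /=; lia.
  rewrite negb_and !negbK.
  case: (blockP xi) (blockP yi) => sx [] sy.
  - by case: nsxy; rewrite sx sy.
  - by rewrite -sx -sy !permK yx eqxx.
  - by rewrite -sx -sy !permK yx eqxx orbT.
  - by case: nsxy; rewrite sx sy.
apply/forallP/blockwiseP => [close|bw i]; last first.
  pose j := blk ((s^-1)%g (lo i)); apply/closeP.
  exists (lo j); last exists (hi j) => //.
    rewrite (bw _ ((s^-1)%g (lo i))) ?permKV ?half_lo //.
  by rewrite (bw _ ((s^-1)%g (lo i))) ?permKV ?half_lo ?half_hi.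
suff bw i : (s (lo i))./2 = (s (hi i))./2.
  by apply/blockwiseP/forallP => i; apply/eqP.
(* Blocks are treated from left to right: the letter at position 2i has its partner in an adjacent
   position. *)
move: {2}(val i) (erefl (val i)) => k; elim/ltn_ind: k i => k IHk i ik.
have /closeP[x xi [y yi yx]] := close (blk (s (lo i))).
have := half_eq_pigeonhole (etrans xi (esym yi)) yi.
rewrite !(inj_eq perm_inj) -!val_eqE /= yx.
case/or3P => [|/eqP e|/eqP e]; first by lia.
  (* A partner on the left would sit at 2i-1; by induction positions 2i-2, 2i-1 and 2i would then
     share one value block. *)
  have lt_j : (i.-1 < m)%N by have := ltn_ord i; lia.
  pose j := Ordinal lt_j.
  have hx : x = hi j by apply: val_inj => /=; lia.
  have := IHk j _ j erefl; rewrite -hx xi.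
  have -> : (j < k)%N by rewrite -ik /=; lia.
  move=> /(_ isT) sj; have := half_eq_pigeonhole (etrans sj (esym xi)) xi.
  by rewrite !(inj_eq perm_inj) -!val_eqE /=; lia.
have -> : hi i = y by apply: val_inj => /=; lia.
by rewrite yi.
Qed.

(** The marker of the cancellation records which of 2i, 2i+1 stands to the left. Any weight
    depending only on the descents is allowed. *)
Lemma sum_blockwise (R : comNzRingType) (w : (nat -> bool) -> R) :
  (forall d d', (forall k, (k.+1 < m.*2)%N -> d k = d' k) -> w d = w d') ->
  \sum_(s : 'S_m.*2) (-1) ^+ s * w (desc s)
  = \sum_(s | blockwise s) (-1) ^+ s * w (desc s).
Proof.
move=> w_ext.
rewrite (sum_cancel (b := @spread)
  (c := fun i s => ((s^-1)%g (lo i) < (s^-1)%g (hi i))%N)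
  (phi := fun i s => (s * flip i)%g)).
- by apply: eq_bigl => s; rewrite all_close_blockwise.
- exact: mul_flipK.
move=> i s _ sp.
have swap x : ((s * flip i)^-1)%g x = (s^-1)%g (flip i x).
  by rewrite invMg permM /flip tpermV.
have flipE : (flip i (lo i) = hi i) * (flip i (hi i) = lo i).
  by rewrite /flip tpermL tpermR.
split=> //.
- move=> j; rewrite /spread !swap //; case: (eqVneq j i) => [->|nji].
    by rewrite !flipE andbC.
  by rewrite !(@flip_id i) ?half_lo ?half_hi.
- rewrite !swap // !flipE -leqNgt ltn_neqAle andb_idl // => _.
  by rewrite (inj_eq (@ord_inj _)) (inj_eq perm_inj) eq_sym lo_neq_hi.
by rewrite sign_mul_flip mulNr (w_ext _ (desc s)) // => k; apply: spread_desc.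
Qed.

(** * Second involution: exchanging the positions of an inner block *)

(** Between unequal outer steps the block contains exactly one peak or valley; toggling its inner
    step only moves this to the other position, whence the reindexing by [flip i]. *)
Lemma peaks_toggle i (d d' : nat -> bool) :
  (0 < i)%N -> (i.+1 < m)%N -> d i.*2.-1 != d i.*2.+1 ->
  d' i.*2 = ~~ d i.*2 -> (forall k, k != i.*2 -> d' k = d k) ->
  peaks m.*2 d' = peaks m.*2 d.
Proof.
move=> i_gt0 lt_i nd d'i d'k; rewrite /peaks -!sum1_card.
rewrite (reindex_inj (@perm_inj _ (flip i))) /=; apply: eq_bigl => x.
have lt1 : (i.*2.+1 < m.*2)%N by lia.
have lt2 : (i.*2.+2 < m.*2)%N by lia.
have gt0 : (0 < i.*2)%N by lia.
rewrite !inE /flip; case: tpermP => [->|->|/eqP nlo /eqP nhi] /=.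
- rewrite d'i d'k ?lt1 ?lt2 ?gt0 /=; last by lia.
  by move: nd; case: (d _.-1); case: (d _.+1); case: (d _).
- rewrite d'i d'k ?lt1 ?lt2 ?gt0 /=; last by lia.
  by move: nd; case: (d _.-1); case: (d _.+1); case: (d _).
move: nlo nhi; rewrite -!val_eqE /= => nlo nhi.
by case: (posnP x) => //= x_gt0; rewrite !d'k //; lia.
Qed.

Lemma weight_toggle (R : comNzRingType) (p q : R) (a b : bool) i
    (d d' : nat -> bool) :
  (0 < i)%N -> (i.+1 < m)%N -> d i.*2.-1 != d i.*2.+1 ->
  d' i.*2 = ~~ d i.*2 -> (forall k, k != i.*2 -> d' k = d k) ->
  weight p q m.*2 a b d' = weight p q m.*2 a b d.
Proof.
move=> i_gt0 lt_i nd d'i d'k; rewrite /weight (peaks_toggle _ _ nd) //.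
rewrite (@peaks_toggle i (fun k => ~~ d k) (fun k => ~~ d' k)) //; first last.
- by move=> k /d'k ->.
- by rewrite d'i.
- by rewrite (inj_eq negb_inj).
by rewrite !d'k //; lia.
Qed.

Lemma blockwise_descE s i j : blockwise s -> j = i.+1 :> nat ->
  desc s i.*2.+1 = ((s (lo j))./2 < (s (lo i))./2)%N.
Proof.
move=> bw ji; rewrite (@descE _ _ (hi i) (lo j)) /= ?ji ?doubleS //.
have nij : (s (lo j))./2 != (s (hi i))./2.
  by apply/eqP => /(blockwise_half_inj bw); rewrite half_lo half_hi ji; lia.
have -> : (s (lo i))./2 = (s (hi i))./2.
  by apply: blockwise_half => //; rewrite half_lo half_hi.
by move: nij; lia.
Qed.

Definition zigzag s i : bool :=
  [&& (0 < i)%N, (i.+1 < m)%N & desc s i.*2.-1 != desc s i.*2.+1].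

Lemma flip_desc_even i j s :
  desc (flip i * s)%g j.*2 = (if j == i then ~~ desc s j.*2 else desc s j.*2).
Proof.
rewrite !(@descE _ _ (lo j) (hi j)) // !permM.
case: eqP => [->|/eqP nji]; last by rewrite !flip_id ?half_lo ?half_hi.
rewrite /flip tpermL tpermR -leqNgt ltn_neqAle andb_idl // => _.
by rewrite (inj_eq (@ord_inj _)) (inj_eq perm_inj) lo_neq_hi.
Qed.

Lemma flip_blockwise i s : blockwise s -> blockwise (flip i * s)%g.
Proof.
move=> bw; apply/blockwiseP => x y xy; rewrite !permM.
by apply: blockwise_half => //; rewrite !half_flip.
Qed.

Lemma flip_desc_odd i s j : blockwise s -> (j.+1 < m)%N ->
  desc (flip i * s)%g j.*2.+1 = desc s j.*2.+1.
Proof.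
move=> bw lt_j; pose j' := Ordinal lt_j.
rewrite !(@blockwise_descE _ j j') ?flip_blockwise // !permM.
by rewrite !(@blockwise_half s (flip i _) _ bw (half_flip _ _)).
Qed.

(** Steps between blocks compare whole value blocks, which an exchange inside a block does not
    affect. *)
Lemma flip_desc i s k : blockwise s -> (k.+1 < m.*2)%N ->
  desc (flip i * s)%g k = (if k == i.*2 then ~~ desc s k else desc s k).
Proof.
move=> bw lt_k; have lt_j : (k./2 < m)%N by lia.
pose j := Ordinal lt_j; case: (boolP (odd k)) => k_odd.
  have -> : k = j.*2.+1 by rewrite /=; lia.
  rewrite flip_desc_odd //=; last by lia.
  by case: eqP => //; lia.
have -> : k = j.*2 by rewrite /=; lia.
by rewrite flip_desc_even -val_eqE /=; congr (if _ then _ else _); lia.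
Qed.

(** The marker is the step inside the block; [zigzag] reads only steps between blocks, so all the
    exchanges preserve it. *)
Lemma sum_no_zigzag (R : comNzRingType) (p q : R) (a b : bool) :
  (1 < m)%N ->
  \sum_(s | blockwise s) (-1) ^+ s * weight p q m.*2 a b (desc s)
  = \sum_(s | blockwise s && [forall i, ~~ zigzag s i])
      (-1) ^+ s * weight p q m.*2 a b (desc s).
Proof.
move=> m_gt1; apply: (sum_cancel (b := fun i s => zigzag s i)
  (c := fun i s => desc s i.*2) (phi := fun i s => (flip i * s)%g)).
  exact: flip_mulK.
move=> i s bw /and3P[i_gt0 lt_i zz]; split.
- exact: flip_blockwise.
- move=> j; rewrite /zigzag; case: (posnP j) => //= j_gt0.
  case: ltnP => //= lt_j; rewrite !flip_desc //; try lia.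
  by rewrite !ifN //; apply/eqP; lia.
- by rewrite flip_desc_even eqxx.
rewrite sign_flip_mul mulNr; congr (- (_ * _)).
rewrite -(weight_toggle (i := i) p q a b (d := desc s)
  (d' := fun k => if k == i.*2 then ~~ desc s k else desc s k)) //.
- by apply: eq_weight => [|k lt_k]; [lia | rewrite flip_desc].
- by rewrite eqxx.
by move=> k /negPf ->.
Qed.

(** * The survivors of both cancellations *)

Definition fixes_blocks s : bool := [forall x, (s x)./2 == x./2].

Lemma fixes_blocks_blockwise s : fixes_blocks s -> blockwise s.
Proof.
by move=> /forallP fx; apply/blockwiseP => x y; rewrite !(eqP (fx _)).
Qed.

(** If all steps between blocks ascend, the induced map on blocks is increasing, hence the
    identity. *)
Lemma fixes_blocksE s :
  fixes_blocks s
  = blockwise s && [forall i : 'I_m, (i.+1 < m)%N ==> ~~ desc s i.*2.+1].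
Proof.
apply/idP/andP => [fx|[bw /forallP up]].
  have bw := fixes_blocks_blockwise fx; split=> //.
  apply/forallP => i; apply/implyP => lt_i; pose j := Ordinal lt_i.
  rewrite (@blockwise_descE _ i j) // !(eqP (forallP fx _)) !half_lo /=; lia.
pose f k := if insub k is Some i then (s (lo i))./2 else 0%N.
have fE i : f i = (s (lo i))./2 by rewrite /f valK.
have f_id : forall k, (k < m)%N -> f k = k.
  apply: incr_bounded_id => k lt_k.
    pose i := Ordinal (ltnW lt_k); pose j := Ordinal lt_k.
    rewrite (fE i : f k = _) (fE j : f k.+1 = _).
    have := implyP (up i) lt_k; rewrite (@blockwise_descE _ i j) // -leqNgt.
    rewrite leq_eqVlt => /orP[/eqP /(blockwise_half_inj bw)|//].
    by rewrite !half_lo /=; lia.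
  by rewrite (fE (Ordinal lt_k) : f k = _) half_ltn.
apply/forallP => x; rewrite (blockwise_half (y := lo (blk x)) bw) ?half_lo //.
by rewrite -fE f_id // half_ltn.
Qed.

(** As a right factor it replaces each value v by 2m-1-v. *)
Definition rev_perm : 'S_m.*2 := perm (@rev_ord_inj m.*2).

Lemma half_rev_ord x : (rev_ord x)./2 = (m.-1 - x./2)%N.
Proof. by rewrite /=; have := ltn_ord x; lia. Qed.

Lemma desc_mul_rev s k : (k.+1 < m.*2)%N ->
  desc (s * rev_perm)%g k = ~~ desc s k.
Proof.
move=> lt_k; pose x := Ordinal (ltnW lt_k); pose y := Ordinal lt_k.
rewrite !(@descE _ _ x y) // !permM !permE /=.
have nsxy : s x <> s y by move/perm_inj/(congr1 val) => /=; lia.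
have {}nsxy : s x != s y :> nat by apply/eqP => /ord_inj.
by have := ltn_ord (s x); have := ltn_ord (s y); lia.
Qed.

Lemma blockwise_mul_rev s : blockwise (s * rev_perm)%g = blockwise s.
Proof.
apply: eq_forallb => i; rewrite !permM !permE !half_rev_ord.
by have := half_ltn (s (lo i)); have := half_ltn (s (hi i)); lia.
Qed.

Lemma no_zigzagE s : (1 < m)%N ->
  blockwise s && [forall i, ~~ zigzag s i]
  = fixes_blocks s || fixes_blocks (s * rev_perm)%g.
Proof.
move=> m_gt1; rewrite !fixes_blocksE blockwise_mul_rev -andb_orr.
case: (blockwise s) => //=.
have -> : [forall i : 'I_m, (i.+1 < m)%N ==> ~~ desc (s * rev_perm)%g i.*2.+1]
    = [forall i : 'I_m, (i.+1 < m)%N ==> desc s i.*2.+1].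
  apply: eq_forallb => i; case: ltnP => //= lt_i.
  by rewrite desc_mul_rev ?negbK //; lia.
apply/forallP/orP => [zz|].
  (* All steps between blocks agree with the first of them, at position 1; its direction decides
     which of the two families contains [s]. *)
  have cst k : (k.+1 < m)%N -> desc s k.*2.+1 = desc s 1.
    elim: k => // k IHk lt_k; rewrite -IHk; last by lia.
    have := zz (Ordinal (ltnW lt_k)); rewrite /zigzag /= lt_k /= negbK.
    by rewrite eq_sym => /eqP.
  case s1 : (desc s 1); [right|left]; apply/forallP => i;
    by apply/implyP => lt_i; rewrite cst ?s1.
case=> /forallP h i; rewrite /zigzag; case: (posnP i) => //= i_gt0;
  case: ltnP => //= lt_i; rewrite negbK.
  have lt1 : (i.-1 < m)%N by lia.
  have := h i; have := h (Ordinal lt1); rewrite /= lt_i prednK // ltn_ord /=.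
  have -> : i.*2.-1 = i.-1.*2.+1 by lia.
  by do 2 move/negPf => ->.
have lt1 : (i.-1 < m)%N by lia.
have := h i; have := h (Ordinal lt1); rewrite /= lt_i prednK // ltn_ord /=.
have -> : i.*2.-1 = i.-1.*2.+1 by lia.
by move=> -> ->.
Qed.

(** Block 0 would be mapped both to block 0 and to block m-1. Hence the two families of survivors
    are disjoint. *)
Lemma fixes_blocks_mul_rev s : (1 < m)%N ->
  ~~ (fixes_blocks s && fixes_blocks (s * rev_perm)%g).
Proof.
move=> m_gt1; apply/negP => /andP[/forallP f1 /forallP f2].
have m_gt0 : (0 < m)%N by lia.
pose x := lo (Ordinal m_gt0).
move: (f1 x) (f2 x); rewrite permM permE half_rev_ord => /eqP -> /=.
by lia.
Qed.

(** All pairs are inverted, and their number m(2m-1) has the parity of m. *)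
Lemma sign_rev_perm (R : pzRingType) : (-1) ^+ rev_perm = (-1) ^+ m :> R.
Proof.
rewrite -sign_inv -signr_odd -[RHS]signr_odd; congr (_ ^+ nat_of_bool _).
have -> : Defs.inv rev_perm = 'C(m.*2, 2).
  rewrite -bin2_sum big_mkord /Defs.inv -sum1_card.
  transitivity (\sum_(i < m.*2) \sum_(j < m.*2 | i < j) 1)%N.
    rewrite pair_big_dep; apply: eq_bigl => [[i j]]; rewrite inE !permE /=.
    by rewrite andb_idl //; have := ltn_ord j; have := ltn_ord i; lia.
  rewrite (exchange_big_dep xpredT) //=; apply: eq_bigr => j _.
  rewrite -(big_ord_widen _ (fun=> 1%N)) ?sum1_card ?card_ord //.
  exact/ltnW/ltn_ord.
rewrite bin2 -doubleMl doubleK oddM.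
by case: (m) => // k; rewrite doubleS /= odd_double andbT.
Qed.

(** * The sum over block-fixing permutations as a product *)

Lemma fixes_blocks_flip i s : fixes_blocks (flip i * s)%g = fixes_blocks s.
Proof.
apply/forallP/forallP => fx x; have := fx (flip i x);
  by rewrite permM ?flipK half_flip.
Qed.

Lemma fixes_blocks_id s :
  fixes_blocks s && [forall i : 'I_m, ~~ desc s i.*2] = (s == 1%g).
Proof.
apply/andP/eqP => [[/forallP fx /forallP up]|->]; last first.
  split; apply/forallP => i; first by rewrite perm1.
  by rewrite (@descE _ _ (lo i) (hi i)) // !perm1 -leqNgt /=.
apply/permP => x; rewrite perm1; pose i := blk x.
have := up i; rewrite (@descE _ _ (lo i) (hi i)) // -leqNgt => le_s.
have := eqP (fx (lo i)); have := eqP (fx (hi i)); rewrite half_lo half_hi.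
have nslh : s (lo i) <> s (hi i).
  by move/perm_inj/eqP; rewrite (negPf (lo_neq_hi i)).
case/blockP => shi; case/blockP => slo;
  try by [case: nslh; rewrite slo shi | move: le_s; rewrite slo shi /=; lia].
by case: (blockP (i := i) (x := x) erefl) => ->.
Qed.

(** A block-fixing permutation is an independent choice of the order inside each block, and each
    descent costs a sign. *)
Lemma sum_fixes_blocks (R : comNzRingType) (u : nat -> bool -> R) :
  \sum_(s | fixes_blocks s) (-1) ^+ s * \prod_(i < m) u i (desc s i.*2)
  = \prod_(i < m) (u i false - u i true).
Proof.
(* Induction on r, where only the first r blocks may descend; for r = 0 the identity alone
   remains. *)
pose asc_from (r : nat) s := [forall i : 'I_m, (r <= i)%N ==> ~~ desc s i.*2].
suff prefix r : (r <= m)%N ->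
    \sum_(s | fixes_blocks s && asc_from r s)
       (-1) ^+ s * \prod_(0 <= k < r) u k (desc s k.*2)
    = \prod_(0 <= k < r) (u k false - u k true).
  have := prefix m (leqnn m); rewrite big_mkord => <-.
  apply: eq_big => [s|s _]; last by rewrite big_mkord.
  rewrite [asc_from _ _](_ : _ = true) ?andbT //.
  by apply/forallP => i; rewrite leqNgt ltn_ord.
elim: r => [_|r IHr lt_r].
  rewrite (big_pred1 1%g) => [|s]; first by rewrite odd_perm1 !big_nil mulr1.
  by rewrite /= -fixes_blocks_id.
pose i := Ordinal lt_r; have {}IHr := IHr (ltnW lt_r).
have asc_fromS s : asc_from r s = asc_from r.+1 s && ~~ desc s r.*2.
  apply/forallP/andP => [up|[/forallP up nd] j].
    split; last exact: (implyP (up i)).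
    by apply/forallP => j; apply/implyP => /ltnW; apply/implyP.
  apply/implyP; rewrite leq_eqVlt => /orP[/eqP <- //|]; exact/implyP.
rewrite big_nat_recr //= mulrBr -IHr !mulr_suml.
rewrite [LHS](bigID (fun s => desc s r.*2)) /=.
rewrite addrC; congr (_ + _).
  apply: eq_big => s; first by rewrite asc_fromS andbA.
  by move=> /andP[_ /negPf nd]; rewrite big_nat_recr //= nd mulrA.
(* Flipping block r turns the terms where it descends into those where it ascends, with the opposite
   sign. *)
rewrite (reindex_inj (inv_inj (flip_mulK i))) -sumrN /=.
apply: eq_big => s; rewrite fixes_blocks_flip (flip_desc_even i i) eqxx ?asc_fromS /=.
  rewrite -andbA; congr (_ && (_ && _)); apply: eq_forallb => j.
  case: ltnP => //= lt_rj; rewrite flip_desc_even ifN // -val_eqE /=; lia.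
move=> /andP[_ nd]; rewrite big_nat_recr //= (flip_desc_even i i) eqxx nd.
rewrite sign_flip_mul mulNr mulrA; congr (- (_ * _ * _)).
apply: eq_big_nat => k /andP[_ lt_k]; congr (u k _).
have lt_km : (k < m)%N by lia.
rewrite (flip_desc_even i (Ordinal lt_km)) ifN // -val_eqE /=; lia.
Qed.

Lemma fixes_blocks_desc_odd s j :
  fixes_blocks s -> (j.+1 < m)%N -> desc s j.*2.+1 = false.
Proof.
rewrite fixes_blocksE => /andP[_ /forallP up] lt_j.
by apply/negbTE; apply: (implyP (up j)).
Qed.

(** Steps between blocks ascend, so a peak can only be the first position of a descending block
    other than block 0. *)
Lemma peaks_fixes_blocks s : fixes_blocks s ->
  peaks m.*2 (desc s) = (\sum_(i < m) ((0 < i) && desc s i.*2))%N.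
Proof.
move=> fx; rewrite peaks_sum.
rewrite (sum_double (fun k =>
  [&& 0 < k, k.+1 < m.*2, ~~ desc s k.-1 & desc s k] : nat)%N).
apply: eq_bigr => i _; rewrite double_gt0 ltn_Sdouble ltn_ord /=.
case: (ltnP i.+1 m) => lt_i; last first.
  rewrite [(_.+2 < _)%N](_ : _ = false) ?andbF /=; last by lia.
  rewrite addn0; case: posnP => //= i_gt0.
  have lt1 : (i.-1 < m)%N by have := ltn_ord i; lia.
  have -> : i.*2.-1 = (Ordinal lt1).*2.+1 by rewrite /=; lia.
  by rewrite fixes_blocks_desc_odd //= prednK // ltn_ord.
rewrite fixes_blocks_desc_odd // !andbF addn0; case: posnP => //= i_gt0.
have lt1 : (i.-1 < m)%N by have := ltn_ord i; lia.
have -> : i.*2.-1 = (Ordinal lt1).*2.+1 by rewrite /=; lia.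
by rewrite fixes_blocks_desc_odd //= prednK // ltn_ord.
Qed.

(** Dually, a valley can only be the second position of a descending block other than the last. *)
Lemma valleys_fixes_blocks s : fixes_blocks s ->
  peaks m.*2 (fun k => ~~ desc s k)
  = (\sum_(i < m) ((i.+1 < m) && desc s i.*2))%N.
Proof.
move=> fx; rewrite peaks_sum.
rewrite (sum_double (fun k =>
  [&& 0 < k, k.+1 < m.*2, ~~ ~~ desc s k.-1 & ~~ desc s k] : nat)%N).
apply: eq_bigr => i _; rewrite double_gt0 ltn_Sdouble ltn_ord /= !negbK.
rewrite [X in (nat_of_bool X + _)%N](_ : _ = false).
  case: (ltnP i.+1 m) => lt_i; last first.
    by rewrite [(_.+2 < _)%N](_ : _ = false) //; lia.
  rewrite fixes_blocks_desc_odd // andbT add0n [(_.+2 < _)%N](_ : _ = true) //.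
  by lia.
case: posnP => //= i_gt0; have lt1 : (i.-1 < m)%N by have := ltn_ord i; lia.
have -> : i.*2.-1 = (Ordinal lt1).*2.+1 by rewrite /=; lia.
by rewrite fixes_blocks_desc_odd //= prednK // ltn_ord.
Qed.

(* The factor of block k, which is a descent iff e holds; a and b prescribe the
   steps inside the first and the last block. *)
Definition block_weight (R : comNzRingType) (p q : R) (a b : bool)
    (k : nat) (e : bool) : R :=
  ((k == 0%N) ==> (e == a))%:R * (((k.+1 == m)%N) ==> (e == b))%:R
  * p ^+ ((0 < k)%N && e) * q ^+ ((k.+1 < m)%N && e).

Lemma weight_fixes_blocks (R : comNzRingType) (p q : R) (a b : bool) s :
  (1 < m)%N -> fixes_blocks s ->
  weight p q m.*2 a b (desc s)
  = \prod_(i < m) block_weight p q a b i (desc s i.*2).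
Proof.
move=> m_gt1 fx; rewrite /weight peaks_fixes_blocks // valleys_fixes_blocks //.
rewrite !big_split /= -!prodrXr; congr (_ * _ * _).
have lt0 : (0 < m)%N by lia.
have ltl : (m.-1 < m)%N by lia.
(* The two products of end conditions reduce to their factors at block 0 and at block m-1. *)
rewrite (bigD1 (Ordinal lt0)) //= big1 ?mulr1; last first.
  by move=> i; rewrite -val_eqE /= => /negPf ->.
rewrite (bigD1 (Ordinal ltl)) //= big1 ?mulr1; last first.
  move=> i; rewrite -val_eqE /= => ni.
  by rewrite [_.+1 == _](_ : _ = false) //; have := ltn_ord i; lia.
rewrite prednK // !eqxx /= -natrM mulnb.
by rewrite [(m.*2 - 2)%N](_ : _ = m.-1.*2) //; lia.
Qed.
End Blocks.

(** * Evaluation for prescribed end steps *)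

(** The factor of an end block whose inner step is prescribed by [e]. *)
Definition end_sign (R : pzRingType) (z : R) (e : bool) : R :=
  if e then - z else 1.

(** A descent creates only a valley in the first block, only a peak in the last, and both in each of
    the m inner blocks. *)
Lemma sum_fixes_blocks_weight (R : comNzRingType) (p q : R) (a b : bool) m :
  \sum_(s : 'S_m.+2.*2 | fixes_blocks s)
     (-1) ^+ s * weight p q m.+2.*2 a b (desc s)
  = end_sign q a * end_sign p b * (1 - p * q) ^+ m.
Proof.
under eq_bigr => s fx do rewrite weight_fixes_blocks //.
rewrite sum_fixes_blocks big_ord_recl big_ord_recr /=.
rewrite (eq_bigr (fun=> 1 - p * q)) => [|i _].
  rewrite prodr_const card_ord mulrAC mulrA; congr (_ * _ * _).
    rewrite /block_weight /=; case: a;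
      by rewrite /= ?(expr0, expr1, mulr0, mul0r, mulr1, mul1r, sub0r, subr0).
  rewrite /block_weight /= /bump /= !eqxx ltnn.
  case: b;
    by rewrite /= ?(expr0, expr1, mulr0, mul0r, mulr1, mul1r, sub0r, subr0).
rewrite /block_weight /= /bump leq0n add1n !eqSS (ltn_eqF (ltn_ord i)) !ltnS.
by rewrite ltn_ord /= !mulr1 !mul1r.
Qed.

(** The two summands come from the block-fixing permutations and from their value reversals;
    reversal complements the end steps, exchanges p and q, and has sign (-1)^m. *)
Lemma SgnAltrun_ends_even (R : comNzRingType) (p q : R) m x y :
  SgnAltrun_ends m.+2.*2 x y p q
  = (end_sign q (is_desc x) * end_sign p (is_desc y)
     + (-1) ^+ m * end_sign p (~~ is_desc x) * end_sign q (~~ is_desc y))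
    * (1 - p * q) ^+ m.
Proof.
rewrite SgnAltrun_endsE //.
rewrite (sum_blockwise (w := weight p q _ _ _)); last by
  move=> d d' dd'; apply: eq_weight.
rewrite sum_no_zigzag //.
rewrite (eq_bigl (fun s =>
  fixes_blocks s || fixes_blocks (s * rev_perm _)%g)); last first.
  by move=> s; rewrite no_zigzagE.
rewrite (bigID (@fixes_blocks _)) /= mulrDl -sum_fixes_blocks_weight.
congr (_ + _); first by apply: eq_bigl => s; rewrite andbC andb_idr // => ->.
rewrite [p * q]mulrC -!mulrA [end_sign p _ * _]mulrA.
rewrite -sum_fixes_blocks_weight mulr_sumr.
(* Reversal carries the second family onto the first; disjointness makes the leftover condition
   equivalent to [fixes_blocks s]. *)
rewrite (reindex_inj (mulIg (rev_perm _))) /=.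
have rev2 : (rev_perm m.+2 * rev_perm m.+2 = 1)%g.
  by apply/permP => z; rewrite permM !permE rev_ordK.
apply: eq_big => s.
  rewrite -mulgA rev2 mulg1.
  have := @fixes_blocks_mul_rev m.+2 s isT.
  by case: (fixes_blocks s); case: (fixes_blocks _).
have sgn2 : (-1) ^+ m.+2 = (-1) ^+ m :> R.
  by rewrite -addn2 exprD sqrrN expr1n mulr1.
move=> _; rewrite -weight_compl.
rewrite odd_permM signr_addb sign_rev_perm sgn2.
rewrite [RHS]mulrCA mulrA; congr (_ * _).
by apply: eq_weight => // k lt_k; rewrite desc_mul_rev ?negbK.
Qed.

Theorem theorem19 (k : nat) (k_gt0 : (0 < k)%N)
    (R : comNzRingType) (p q : R) :
  [/\ SgnAltrun_ends (4 * k) Asc Asc p q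
        = (1 + p * q) * (1 - p * q) ^+ (2 * (k - 1)),
      SgnAltrun_ends (4 * k) Desc Desc p q
        = (1 + p * q) * (1 - p * q) ^+ (2 * (k - 1)),
      SgnAltrun_ends (4 * k) Asc Desc p q
        = - 2 * p * (1 - p * q) ^+ (2 * (k - 1)),
      SgnAltrun_ends (4 * k) Desc Asc p q
        = - 2 * q * (1 - p * q) ^+ (2 * (k - 1))
    & SgnAltrun (4 * k) p q
        = 2 * (1 - p) * (1 - q) * (1 - p * q) ^+ (2 * (k - 1))].
Proof.
(* There are 2k blocks, of which the inner ones number 2(k-1); this is even, so the reversed family
   enters with sign +1. *)
have -> : (4 * k = (2 * (k - 1)).+2.*2)%N by lia.
rewrite SgnAltrunE // !SgnAltrun_ends_even.
rewrite [(-1) ^+ _]exprM sqrrN expr1n expr1n.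
move: (_ ^+ _) => z; rewrite /=.
by split; ring.
Qed.
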